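(* Let $m\ge n$ and consider $k$ steps of the reorthogonalized joint bidiagonalization (rJBD) process of $\{A,L\}$ (see context). Then there exist a column orthonormal matrix $\bar U_k\in\mathbb{R}^{m\times k}$ and a matrix $E_k\in\mathbb{R}^{m\times n}$ such that $$(Q_A+E_k)V_k=\bar U_kB_k,$$ $$(Q_A+E_k)^T\bar U_k=V_kB_k^T+\beta_kv_{k+1}(e_k^{(k)})^T,$$ and $$\|E_k\|=\mathcal{O}(\sqrt n\,k\,\kappa(C)\tau).$$
   Context: $\|\cdot\|$ is the 2-norm; $e_i^{(r)}$ is the $i$-th column of $I_r$; $0_r$ is the zero vector of $\mathbb{R}^r$. Let $A\in\mathbb{R}^{m\times n}$, $L\in\mathbb{R}^{p\times n}$, $C=\begin{pmatrix}A\\L\end{pmatrix}$ with $\mathrm{rank}(C)=n$, $\kappa(C)=\|C\|\|C^\dagger\|$, and let $C=QR$ be the compact QR factorization, $Q=\begin{pmatrix}Q_A\\Q_L\end{pmatrix}$ with orthonormal columns, $Q_A\in\mathbb{R}^{m\times n}$, $Q_L\in\mathbb{R}^{p\times n}$, $R$ upper triangular and nonsingular. rJBD process with tolerance $\tau$: choose a nonzero starting vector $s_0\in\mathbb{R}^n$, set $\tilde v_1=Cs_0/\|Cs_0\|$, $\beta_0=\hat\beta_0=0$, and for $i=1,\dots,k$: (1) $\alpha_iu_i=\tilde v_i(1:m)-\beta_{i-1}u_{i-1}$, $\|u_i\|=1$; (2) with $\tilde u_i=(u_i^T,0_p^T)^T$, compute an approximate solution $\bar z_i$ of $\min_{\tilde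 z\in\mathbb{R}^n}\|C\tilde z-\tilde u_i\|$ whose residual $\bar r_i=\tilde u_i-C\bar z_i$ satisfies $\|C^T\bar r_i\|/(\|C\|\|\bar r_i\|)\le\tau$; (3) $s_i=C\bar z_i-\alpha_i\tilde v_i$ and $\beta_i\tilde v_{i+1}=s_i-\sum_{j=1}^i(s_i^T\tilde v_j)\tilde v_j$, $\|\tilde v_{i+1}\|=1$; (4) $\hat\alpha_i\hat u_i=(-1)^{i-1}\tilde v_i(m+1:m+p)-\hat\beta_{i-1}\hat u_{i-1}$, $\|\hat u_i\|=1$; $\hat\beta_i=\alpha_i\beta_i/\hat\alpha_i$. All of $\alpha_i,\beta_i,\hat\alpha_i,\hat\beta_i$ are assumed positive during the $k$ steps (no termination; in the extreme case $k=n$ one has $\beta_n\tilde v_{n+1}=0$ and that term is zero), and all computations other than (2) are exact. Each $\tilde v_i$ lies in the range of $Q$, and $v_i\in\mathbb{R}^n$ is defined by $\tilde v_i=Qv_i$; $V_k=(v_1,\dots,v_k)$. $B_k\in\mathbb{R}^{k\times k}$ is upper bidiagonal with diagonal $\alpha_1,\dots,\alpha_k$ and superdiagonal $\beta_1,\dots,\beta_{k-1}$. Convention: a bound $\mathcal{O}(\phi)$ means at most a constant times $\phi$ when $\kappa(C)\tau$ is sufficiently small, terms of higher order in $\tau$ being neglected; the constant is absolute (dependence on $k$, $n$, $\kappa(C)$, $\tau$ is displayed in $\phi$), while the smallness threshold may depend on $m,n,p,k$. *)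

(* Defs.v *)
From HB Require Import structures.
From mathcomp Require Import all_boot all_order all_algebra.
From mathcomp Require Import boolp classical_sets reals.

Set Implicit Arguments.
Unset Strict Implicit.
Unset Printing Implicit Defensive.

Import Order.TTheory GRing.Theory Num.Theory.

Local Open Scope classical_set_scope.
Local Open Scope ring_scope.

(* MathComp-Analysis equips matrices with the max norm of their entries, so
   the 2-norms of vectors and matrices are defined here. *)
Definition norm2 (R : realType) (n : nat) (x : 'cV[R]_n) : R :=
  Num.sqrt (\sum_i x i 0 ^+ 2).

Definition mxnorm2 (R : realType) (m n : nat) (A : 'M[R]_(m, n)) : R :=
  sup [set norm2 (A *m x) | x in [set x : 'cV[R]_n | norm2 x <= 1]].

(* The four Penrose equations; [pinvmx] of MathComp is not the Moore-Penrose
   inverse. *)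
Definition is_MP_inverse (R : realType) (m n : nat)
    (A : 'M[R]_(m, n)) (X : 'M[R]_(n, m)) : Prop :=
  [/\ A *m X *m A = A,
      X *m A *m X = X,
      (A *m X)^T = A *m X
    & (X *m A)^T = X *m A].

Definition MP_inverse (R : realType) (m n : nat) (A : 'M[R]_(m, n)) :
    'M[R]_(n, m) :=
  xget 0 [set X | is_MP_inverse A X].

Definition cond2 (R : realType) (m n : nat) (A : 'M[R]_(m, n)) : R :=
  mxnorm2 A * mxnorm2 (MP_inverse A).

Definition col_orthonormal (R : realType) (m n : nat) (Q : 'M[R]_(m, n)) :
    Prop :=
  Q^T *m Q = 1%:M.

Definition compact_QR (R : realType) (m n : nat) (C Q : 'M[R]_(m, n))
    (T : 'M[R]_n) : Prop :=
  [/\ C = Q *m T,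
      col_orthonormal Q,
      forall i j : 'I_n, (j < i)%N -> T i j = 0
    & T \in unitmx].

(* The i-th column of the identity matrix of order r, for 1 <= i <= r. *)
Definition unit_col (R : realType) (r i : nat) : 'cV[R]_r :=
  \col_(j < r) (j.+1 == i)%:R.

(* All sequences are indexed from 1; index 0 is only meaningful for [beta]
   and [betah]. *)
Record rJBD_run (R : realType) (m n p : nat) := RJBDRun {
  start  : 'cV[R]_n;
  alpha  : nat -> R;
  beta   : nat -> R;
  alphah : nat -> R;
  betah  : nat -> R;
  u      : nat -> 'cV[R]_m;
  uh     : nat -> 'cV[R]_p;
  vt     : nat -> 'cV[R]_(m + p);
  zbar   : nat -> 'cV[R]_n
}.

Section Step.

Variables (R : realType) (m n p : nat).
Variables (A : 'M[R]_(m, n)) (L : 'M[R]_(p, n)) (tau : R).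
Variable D : rJBD_run R m n p.

Let C : 'M[R]_(m + p, n) := col_mx A L.

Definition ut (i : nat) : 'cV[R]_(m + p) := col_mx (u D i) 0.

Definition inner_residual (i : nat) : 'cV[R]_(m + p) :=
  ut i - C *m zbar D i.

Definition rJBD_s (i : nat) : 'cV[R]_(m + p) :=
  C *m zbar D i - alpha D i *: vt D i.

(* In [inner_stop], an exact inner solve (zero residual) passes the test, as
   0 / 0 = 0.  Step n necessarily yields a zero right-hand side in
   [right_eq], so that vt (n+1) cannot be normalized with beta n positive:
   hence the distinction between i < n and i = n. *)
Record rJBD_step (i : nat) : Prop := RJBDStep {
  left_eq : alpha D i *: u D i =
    usubmx (vt D i) - beta D i.-1 *: u D i.-1;
  left_unit : norm2 (u D i) = 1;
  alpha_gt0 : 0 < alpha D i;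
  inner_stop :
    norm2 (C^T *m inner_residual i) / (mxnorm2 C * norm2 (inner_residual i))
      <= tau;
  right_eq : beta D i *: vt D i.+1 =
    rJBD_s i -
    \sum_(1 <= j < i.+1) ((rJBD_s i)^T *m vt D j) 0 0 *: vt D j;
  right_unit : (i < n)%N -> norm2 (vt D i.+1) = 1;
  beta_gt0 : (i < n)%N -> 0 < beta D i;
  right_last : i = n -> beta D i *: vt D i.+1 = 0;
  lefth_eq : alphah D i *: uh D i =
    (-1) ^+ i.-1 *: dsubmx (vt D i) - betah D i.-1 *: uh D i.-1;
  lefth_unit : norm2 (uh D i) = 1;
  alphah_gt0 : 0 < alphah D i;
  betah_eq : betah D i = alpha D i * beta D i / alphah D i;
  betah_gt0 : (i < n)%N -> 0 < betah D i
}.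

Record rJBD_process (k : nat) : Prop := RJBDProcess {
  start_neq0 : start D != 0;
  vt1_eq : vt D 1 = (norm2 (C *m start D))^-1 *: (C *m start D);
  beta0_eq : beta D 0 = 0;
  betah0_eq : betah D 0 = 0;
  steps : forall i, (1 <= i <= k)%N -> rJBD_step i
}.

End Step.

Definition Vmx (R : realType) (n : nat) (v : nat -> 'cV[R]_n) (k : nat) :
    'M[R]_(n, k) :=
  \matrix_(i < n, j < k) v j.+1 i 0.

Definition Bmx (R : realType) (alpha beta : nat -> R) (k : nat) : 'M[R]_k :=
  \matrix_(i < k, j < k)
    if j == i :> nat then alpha i.+1
    else if j == i.+1 :> nat then beta i.+1
    else 0.

(* Main.v *)
Require Import Defs.
From HB Require Import structures.
From mathcomp Require Import all_boot all_order all_algebra.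
From mathcomp Require Import boolp classical_sets reals.
From mathcomp Require Import ring lra zify.

Set Implicit Arguments.
Unset Strict Implicit.
Unset Printing Implicit Defensive.

Import Order.TTheory GRing.Theory Num.Theory.
Local Open Scope ring_scope.

(** Write [M] for the upper block [Q_A], [U] for the matrix of the computed
left vectors, [V] for that of the vectors [v_i], and [eps] for
[2 * kappa * tau].  The left recurrence is exact: [M V = U B].  The residual
of the inner least squares problem is almost orthogonal to the range of [C]:
its component there has norm at most [eps].  Since the right vectors are
reorthogonalized exactly, [V] is orthonormal and
[M^T u_i = V_i V_i^T M^T u_i + beta_i v_(i+1) + h_i] with [|h_i| <= eps].

The columns of [U] are unit vectors that may lose their orthogonality.  Let
[S] be the strictly upper part of [U^T U], and let [H] have the rows [h_i^T].
Because [B] is upper bidiagonal, the recurrences say exactly that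
[U^T M = (1 + S)^T B V^T + beta_k e_k v_(k+1)^T + H] ([right_bidiagonal]), and
multiplication by [V] gives [S B = H V].  Paige's augmentation of a matrix
with unit columns now applies: with [K = (1 + S)^-1] and [P = S K] the matrix
[W = (P; U K)] has orthonormal columns whatever the size of [S], since
[S^T S + U^T U = (1 + S)^T (1 + S)].  All error terms can be expressed through
[P H], [U K H], [K H] and [K^T H], hence have norm at most [2 |H|], and an
exact relation [Ah V = W B], [W^T Ah = B V^T + beta_k e_k v_(k+1)^T] holds for
a matrix [Ah] that is close to [(0; M)] ([bidiag_perturbation]).

It remains to get rid of the [k] additional rows.  The left factor is
determined by its product with [B], which is invertible, so only the Gram
matrix of [Ah] matters: every [m x n] matrix [M'] with
[M'^T M' = Ah^T Ah] satisfies the same two relations with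
[Ubar = M' V B^-1] in place of [W].  As [n <= m], such an [M'] is obtained from
the lower block of [Ah] by absorbing the rows of its upper block one at a
time, each at a cost of at most the norm of that row ([gram_row_update],
[gram_update]).  The total is
[(3 + 4 k) |H| <= 7 k * sqrt k * eps <= 14 * sqrt n * k * kappa * tau]. *)

(** * The Frobenius inner product and norm *)

Definition fdot (R : realType) (m n : nat) (X Y : 'M[R]_(m, n)) : R :=
  \tr (X^T *m Y).

(** The Frobenius norm dominates the spectral norm and agrees with the 2-norm on
columns, and its square is additive over blocks; all error estimates below are
made in it. *)
Definition fnorm (R : realType) (m n : nat) (X : 'M[R]_(m, n)) : R :=
  Num.sqrt (fdot X X).

Section Frobenius.
Variable R : realType.

Lemma fdotE m n (X Y : 'M[R]_(m, n)) : fdot X Y = \sum_j \sum_i X i j * Y i j.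
Proof.
by apply: eq_bigr => j _; rewrite mxE; apply: eq_bigr => i _; rewrite mxE.
Qed.

Lemma fdotC m n (X Y : 'M[R]_(m, n)) : fdot X Y = fdot Y X.
Proof.
by rewrite !fdotE; apply: eq_bigr => j _; apply: eq_bigr => i _; rewrite mulrC.
Qed.

Lemma fdotDr m n (X Y Z : 'M[R]_(m, n)) : fdot X (Y + Z) = fdot X Y + fdot X Z.
Proof. by rewrite /fdot mulmxDr linearD. Qed.

Lemma fdotZr m n a (X Y : 'M[R]_(m, n)) : fdot X (a *: Y) = a * fdot X Y.
Proof. by rewrite /fdot -scalemxAr linearZ. Qed.

Lemma fdotDl m n (X Y Z : 'M[R]_(m, n)) : fdot (Y + Z) X = fdot Y X + fdot Z X.
Proof. by rewrite fdotC fdotDr !(fdotC X). Qed.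

Lemma fdotZl m n a (X Y : 'M[R]_(m, n)) : fdot (a *: Y) X = a * fdot Y X.
Proof. by rewrite fdotC fdotZr fdotC. Qed.

Lemma fdot_mulmxl m n q (A : 'M[R]_(m, n)) (X : 'M_(n, q)) (Y : 'M_(m, q)) :
  fdot (A *m X) Y = fdot X (A^T *m Y).
Proof. by rewrite /fdot trmx_mul mulmxA. Qed.

Lemma fdot_ge0 m n (X : 'M[R]_(m, n)) : 0 <= fdot X X.
Proof.
by rewrite fdotE; do 2!apply: sumr_ge0 => ? _; rewrite -expr2 sqr_ge0.
Qed.

Lemma fnorm_ge0 m n (X : 'M[R]_(m, n)) : 0 <= fnorm X.
Proof. exact: sqrtr_ge0. Qed.

Lemma fnorm_sqr m n (X : 'M[R]_(m, n)) : fnorm X ^+ 2 = fdot X X.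
Proof. by rewrite sqr_sqrtr ?fdot_ge0. Qed.

Lemma fnorm0 m n : fnorm (0 : 'M[R]_(m, n)) = 0.
Proof. by rewrite /fnorm /fdot mulmx0 mxtrace0 sqrtr0. Qed.

Lemma fnorm0_eq0 m n (X : 'M[R]_(m, n)) : fnorm X = 0 -> X = 0.
Proof.
move=> X0; have: fdot X X = 0 by rewrite -fnorm_sqr X0 expr0n.
rewrite fdotE => /eqP; rewrite psumr_eq0 => [/allP XP|j _]; last first.
  by apply: sumr_ge0 => i _; rewrite -expr2 sqr_ge0.
apply/matrixP => i j; rewrite mxE; have := XP j (mem_index_enum _).
rewrite /= psumr_eq0 => [/allP XiP|l _]; last by rewrite -expr2 sqr_ge0.
by have := XiP i (mem_index_enum _); rewrite /= mulf_eq0 orbb => /eqP.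
Qed.

(** Cauchy-Schwarz, from the nonnegativity of the squared norm of
[|Y| X - |X| Y]. *)
Lemma fdot_le m n (X Y : 'M[R]_(m, n)) : fdot X Y <= fnorm X * fnorm Y.
Proof.
have [X0|Xn0] := eqVneq (fnorm X) 0.
  by rewrite X0 (fnorm0_eq0 X0) mul0r /fdot trmx0 mul0mx mxtrace0.
have [Y0|Yn0] := eqVneq (fnorm Y) 0.
  by rewrite Y0 (fnorm0_eq0 Y0) mulr0 /fdot mulmx0 mxtrace0.
have XY_gt0 : 0 < fnorm X * fnorm Y.
  by rewrite mulr_gt0 // lt_def fnorm_ge0 andbT.
have := fdot_ge0 (fnorm Y *: X + (- fnorm X) *: Y).
rewrite !(fdotDl, fdotDr, fdotZl, fdotZr) (fdotC Y X) -!fnorm_sqr.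
move=> sq_ge0; rewrite -subr_ge0 -(pmulr_rge0 _ XY_gt0).
rewrite -(pmulr_rge0 _ (ltr0Sn R 1)); apply: le_trans sq_ge0 _.
by rewrite le_eqVlt; apply/orP; left; apply/eqP; ring.
Qed.

Lemma fnormD m n (X Y : 'M[R]_(m, n)) : fnorm (X + Y) <= fnorm X + fnorm Y.
Proof.
rewrite -ler_sqr ?nnegrE ?addr_ge0 ?fnorm_ge0 // sqrrD !fnorm_sqr.
rewrite fdotDl !fdotDr (fdotC Y X).
have := fdot_le X Y; lra.
Qed.

Lemma fnormZ m n a (X : 'M[R]_(m, n)) : fnorm (a *: X) = `|a| * fnorm X.
Proof.
by rewrite /fnorm fdotZl fdotZr mulrA -expr2 sqrtrM ?sqr_ge0 // sqrtr_sqr.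
Qed.

Lemma fnormN m n (X : 'M[R]_(m, n)) : fnorm (- X) = fnorm X.
Proof. by rewrite -scaleN1r fnormZ normrN1 mul1r. Qed.

Lemma fnormB m n (X Y : 'M[R]_(m, n)) : fnorm (X - Y) <= fnorm X + fnorm Y.
Proof. by rewrite -(fnormN Y) fnormD. Qed.

Lemma fnorm_tr m n (X : 'M[R]_(m, n)) : fnorm X^T = fnorm X.
Proof. by rewrite /fnorm /fdot trmxK mxtrace_mulC. Qed.

Lemma fnorm_outer m n (y : 'cV[R]_m) (x : 'rV[R]_n) :
  fnorm (y *m x) = fnorm y * fnorm x.
Proof.
rewrite /fnorm -sqrtrM ?fdot_ge0 //; congr Num.sqrt.
rewrite /fdot trmx_mul -mulmxA mxtrace_mulC [y^T *m (y *m x)]mulmxA.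
rewrite [y^T *m y]mx11_scalar mul_scalar_mx -scalemxAl linearZ /=.
by rewrite [\tr (x *m _)]mxtrace_mulC mxtrace_scalar.
Qed.

(** With [y = A x], the square of [|y|] is the inner product of [A] with the
outer product [y x^T], to which Cauchy-Schwarz applies. *)
Lemma fnorm_mulmx_cV m n (A : 'M[R]_(m, n)) (x : 'cV_n) :
  fnorm (A *m x) <= fnorm A * fnorm x.
Proof.
have [->|nz] := eqVneq (fnorm (A *m x)) 0; first by rewrite mulr_ge0 ?fnorm_ge0.
have gt0 : 0 < fnorm (A *m x) by rewrite lt_def nz fnorm_ge0.
rewrite -(ler_pM2r gt0) -expr2 fnorm_sqr fdot_mulmxl.
set y := A *m x; have := fdot_le A (y *m x^T).
rewrite fnorm_outer fnorm_tr /fdot mulmxA [X in X <= _]mxtrace_mulC.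
by rewrite (mulrC (fnorm y)) mulrA.
Qed.

Lemma fnorm_isometry m n q (W : 'M[R]_(m, n)) (X : 'M_(n, q)) :
  W^T *m W = 1%:M -> fnorm (W *m X) = fnorm X.
Proof. by move=> W1; rewrite /fnorm fdot_mulmxl mulmxA W1 mul1mx. Qed.

(** The adjoint obeys the same bound: [|P^T X|^2] is the inner product of [X]
with [P (P^T X)]. *)
Lemma fnorm_adjoint m n q (P : 'M[R]_(m, n)) a (X : 'M_(m, q)) :
  0 <= a -> (forall Y : 'M_(n, q), fnorm (P *m Y) <= a * fnorm Y) ->
  fnorm (P^T *m X) <= a * fnorm X.
Proof.
move=> a0 Pa; set Z := P^T *m X.
have [->|nz] := eqVneq (fnorm Z) 0; first by rewrite mulr_ge0 ?fnorm_ge0.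
have gt0 : 0 < fnorm Z by rewrite lt_def nz fnorm_ge0.
rewrite -(ler_pM2r gt0) -expr2 fnorm_sqr {1}/Z fdot_mulmxl trmxK.
apply: le_trans (fdot_le _ _) _; rewrite (mulrC a) -mulrA.
by rewrite ler_wpM2l ?fnorm_ge0.
Qed.

Lemma fnorm_coisometry m n q (W : 'M[R]_(m, n)) (X : 'M_(m, q)) :
  W^T *m W = 1%:M -> fnorm (W^T *m X) <= fnorm X.
Proof.
move=> W1; rewrite -[leRHS]mul1r; apply: fnorm_adjoint => // Y.
by rewrite fnorm_isometry // mul1r.
Qed.

Lemma fnorm_proj n q (Pi : 'M[R]_n) (X : 'M_(n, q)) :
  Pi^T = Pi -> Pi *m Pi = Pi -> fnorm (Pi *m X) <= fnorm X.
Proof.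
move=> PiT Pi2.
have [->|nz] := eqVneq (fnorm (Pi *m X)) 0; first exact: fnorm_ge0.
have gt0 : 0 < fnorm (Pi *m X) by rewrite lt_def nz fnorm_ge0.
rewrite -(ler_pM2r gt0) -expr2 fnorm_sqr fdot_mulmxl PiT mulmxA Pi2.
exact: fdot_le.
Qed.

Lemma fnorm_projr n q (Pi : 'M[R]_n) (X : 'M_(q, n)) :
  Pi^T = Pi -> Pi *m Pi = Pi -> fnorm (X *m Pi) <= fnorm X.
Proof.
by move=> PiT Pi2; rewrite -fnorm_tr -(fnorm_tr X) trmx_mul PiT fnorm_proj.
Qed.

Lemma range_proj m n (V : 'M[R]_(m, n)) : V^T *m V = 1%:M ->
  (V *m V^T)^T = V *m V^T /\ V *m V^T *m (V *m V^T) = V *m V^T.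
Proof.
by move=> V1; rewrite trmx_mul trmxK mulmxA -(mulmxA V) V1 mulmx1.
Qed.

Lemma compl_proj m n (V : 'M[R]_(m, n)) : V^T *m V = 1%:M ->
  (1%:M - V *m V^T)^T = 1%:M - V *m V^T /\
  (1%:M - V *m V^T) *m (1%:M - V *m V^T) = 1%:M - V *m V^T.
Proof.
move=> /range_proj[VT V2]; rewrite linearB /= trmx1 VT; split=> //.
by rewrite mulmxBr mulmx1 mulmxBl V2 mul1mx subrr subr0.
Qed.

Lemma compl_proj_mul m n (V : 'M[R]_(m, n)) :
  V^T *m V = 1%:M -> (1%:M - V *m V^T) *m V = 0.
Proof. by move=> V1; rewrite mulmxBl mul1mx -mulmxA V1 mulmx1 subrr. Qed.

Lemma tr_mul_compl_proj m n (V : 'M[R]_(m, n)) :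
  V^T *m V = 1%:M -> V^T *m (1%:M - V *m V^T) = 0.
Proof. by move=> V1; rewrite mulmxBr mulmx1 mulmxA V1 mul1mx subrr. Qed.

Lemma fnorm_col_mx m1 m2 n (X : 'M[R]_(m1, n)) (Y : 'M_(m2, n)) :
  fnorm (col_mx X Y) ^+ 2 = fnorm X ^+ 2 + fnorm Y ^+ 2.
Proof. by rewrite !fnorm_sqr /fdot tr_col_mx mul_row_col linearD. Qed.

Lemma fnorm_usub m1 m2 n (X : 'M[R]_(m1 + m2, n)) : fnorm (usubmx X) <= fnorm X.
Proof.
rewrite -ler_sqr ?nnegrE ?fnorm_ge0 // -{2}(vsubmxK X) fnorm_col_mx.
by rewrite lerDl sqr_ge0.
Qed.

Lemma fnorm_dsub m1 m2 n (X : 'M[R]_(m1 + m2, n)) : fnorm (dsubmx X) <= fnorm X.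
Proof.
rewrite -ler_sqr ?nnegrE ?fnorm_ge0 // -{2}(vsubmxK X) fnorm_col_mx.
by rewrite lerDr sqr_ge0.
Qed.

Lemma norm2E n (x : 'cV[R]_n) : norm2 x = fnorm x.
Proof.
by rewrite /norm2 /fnorm fdotE big_ord1; under eq_bigr do rewrite expr2.
Qed.

Lemma fnorm_rows m n (X : 'M[R]_(m, n)) :
  fnorm X ^+ 2 = \sum_i fnorm (row i X) ^+ 2.
Proof.
rewrite fnorm_sqr fdotE exchange_big; apply: eq_bigr => i _.
rewrite fnorm_sqr fdotE; apply: eq_bigr => j _.
by rewrite big_ord1 !mxE.
Qed.

Lemma mxnorm2_le_fnorm m n (A : 'M[R]_(m, n)) : mxnorm2 A <= fnorm A.
Proof.
apply: ge_sup.
  by exists (norm2 (A *m 0)), 0; rewrite //= norm2E fnorm0.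
move=> _ [x /= x1 <-]; rewrite !norm2E in x1 *.
by apply: le_trans (fnorm_mulmx_cV _ _) _; rewrite ler_piMr ?fnorm_ge0.
Qed.

Lemma le_mxnorm2 m n (A : 'M[R]_(m, n)) (x : 'cV_n) :
  fnorm x <= 1 -> fnorm (A *m x) <= mxnorm2 A.
Proof.
move=> x1; apply: ub_le_sup; last by exists x; rewrite /= norm2E.
exists (fnorm A) => _ [z /= z1 <-]; rewrite !norm2E in z1 *.
by apply: le_trans (fnorm_mulmx_cV _ _) _; rewrite ler_piMr ?fnorm_ge0.
Qed.

Lemma mxnorm2_ge0 m n (A : 'M[R]_(m, n)) : 0 <= mxnorm2 A.
Proof.
by apply: le_trans (le_mxnorm2 A (x := 0) _); rewrite ?fnorm_ge0 ?fnorm0.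
Qed.

Lemma mxnorm2P m n (A : 'M[R]_(m, n)) (x : 'cV_n) :
  fnorm (A *m x) <= mxnorm2 A * fnorm x.
Proof.
have [x0|nz] := eqVneq (fnorm x) 0.
  by rewrite (fnorm0_eq0 x0) mulmx0 !fnorm0 mulr0.
have gt0 : 0 < fnorm x by rewrite lt_def nz fnorm_ge0.
have inv_gt0 : 0 < (fnorm x)^-1 by rewrite invr_gt0.
rewrite -ler_pdivrMr // mulrC -[X in X * _](gtr0_norm inv_gt0).
by rewrite -fnormZ scalemxAr le_mxnorm2 // fnormZ gtr0_norm // mulVf.
Qed.

Lemma mxnorm2_trP m n (A : 'M[R]_(m, n)) (x : 'cV_m) :
  fnorm (A^T *m x) <= mxnorm2 A * fnorm x.
Proof. by apply: fnorm_adjoint (mxnorm2_ge0 _) _; apply: mxnorm2P. Qed.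

End Frobenius.

(** * Absorbing additional rows into a Gram matrix *)

Section Gram.
Variable R : realType.

Lemma unit_left_kernel m n (X : 'M[R]_(1 + m, n)) : (n <= m)%N ->
  exists2 w : 'rV[R]_(1 + m), w *m X = 0 &
    fnorm w = 1 /\ 0 <= lsubmx w 0 0.
Proof.
move=> nm; set z := nz_row (kermx X).
have z_ker : z *m X = 0 by apply/sub_kermxP/nz_row_sub.
have z_gt0 : 0 < fnorm z.
  rewrite lt_def fnorm_ge0 andbT; apply/negP => /eqP /fnorm0_eq0 /eqP.
  rewrite nz_row_eq0 -mxrank_eq0 mxrank_ker subn_eq0 leqNgt ltnS.
  by rewrite (leq_trans (rank_leq_col X)).
set w := (fnorm z)^-1 *: z.
have w1 : fnorm w = 1 by rewrite fnormZ gtr0_norm ?invr_gt0 // mulVf ?gt_eqF.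
have wX : w *m X = 0 by rewrite -scalemxAl z_ker scaler0.
have [w_ge0|w_lt0] := lerP 0 (lsubmx w 0 0); first by exists w.
exists (- w); first by rewrite mulNmx wX oppr0.
by rewrite fnormN w1 linearN mxE oppr_ge0 ltW.
Qed.

(** Let [(z, y)] be a unit vector, [z >= 0], orthogonal to the columns of the
matrix with rows [e] and [N]; one exists because [n <= m].  The Householder
reflection exchanging [(z, y)] with minus the first unit vector clears the row
[e] and turns [N] into [N - (1 + z)^-1 y^T e].  The choice of the sign of [z]
makes this correction no larger than [e]. *)
Lemma gram_row_update m n (N : 'M[R]_(m, n)) (e : 'rV_n) : (n <= m)%N ->
  exists2 N' : 'M[R]_(m, n),
    N'^T *m N' = N^T *m N + e^T *m e & fnorm (N' - N) <= fnorm e.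
Proof.
move=> nm; have [w] := unit_left_kernel (col_mx e N) nm.
rewrite -[w]hsubmxK; set y := rsubmx w; set l := lsubmx w.
rewrite mul_row_col row_mxKl => /eqP; rewrite addrC addr_eq0 => /eqP yN [w1 z_ge0].
set z := l 0 0 in z_ge0; have lz : l = z%:M by rewrite [LHS]mx11_scalar.
rewrite lz mul_scalar_mx in yN.
have yy : y *m y^T = (1 - z ^+ 2)%:M.
  have: fnorm (row_mx l y)^T ^+ 2 = 1 by rewrite fnorm_tr w1 expr1n.
  rewrite tr_row_mx fnorm_col_mx !fnorm_sqr /fdot !trmxK lz tr_scalar_mx.
  rewrite -scalar_mxM mxtrace_scalar trace_mx11 -expr2 => <-.
  by rewrite [LHS]mx11_scalar mulr1n addrAC subrr add0r.
have z1_gt0 : 0 < 1 + z by rewrite ltr_pwDl.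
have y_le1 : fnorm y <= 1 + z.
  have: fnorm y <= 1.
    rewrite -(ler_sqr (fnorm_ge0 _)) ?nnegrE // -fnorm_tr fnorm_sqr /fdot trmxK.
    by rewrite yy mxtrace_scalar mulr1n expr1n gerBl sqr_ge0.
  by move/le_trans; apply; rewrite lerDl.
exists (N - (1 + z)^-1 *: (y^T *m e)); last first.
  rewrite addrAC subrr add0r fnormN fnormZ gtr0_norm ?invr_gt0 //.
  by rewrite fnorm_outer fnorm_tr mulrA ler_piMl ?fnorm_ge0 // ler_pdivrMl ?mulr1.
have Ny : N^T *m y^T = - (z *: e^T) by rewrite -trmx_mul yN linearN linearZ.
have -> : (N - (1 + z)^-1 *: (y^T *m e))^T = N^T - (1 + z)^-1 *: (e^T *m y).
  by rewrite linearB linearZ /= trmx_mul trmxK.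
have NyE : N^T *m (y^T *m e) = - z *: (e^T *m e).
  by rewrite mulmxA Ny mulNmx -scalemxAl scaleNr.
have eyN : e^T *m y *m N = - z *: (e^T *m e).
  by rewrite -mulmxA yN mulmxN -scalemxAr scaleNr.
have eyye : e^T *m y *m (y^T *m e) = (1 - z ^+ 2) *: (e^T *m e).
  by rewrite -mulmxA (mulmxA y) yy mul_scalar_mx -scalemxAr.
rewrite mulmxBl !mulmxBr -!scalemxAr -!scalemxAl NyE eyN eyye !scalerA.
rewrite opprB -addrA; congr (_ + _).
rewrite -!scaleNr -!scalerDl -[RHS]scale1r; congr (_ *: _).
by field; rewrite gt_eqF.
Qed.

Lemma gram_vsub m1 m2 n (X : 'M[R]_(m1 + m2, n)) :
  X^T *m X = (usubmx X)^T *m usubmx X + (dsubmx X)^T *m dsubmx X.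
Proof. by rewrite -{1 2}(vsubmxK X) tr_col_mx mul_row_col. Qed.

Lemma gram_update m n k (N : 'M[R]_(m, n)) (E : 'M_(k, n)) : (n <= m)%N ->
  exists2 N' : 'M[R]_(m, n),
    N'^T *m N' = N^T *m N + E^T *m E & fnorm (N' - N) <= k%:R * fnorm E.
Proof.
move=> nm; elim: k E => [|k IHk] E.
  by exists N; rewrite ?subrr ?fnorm0 ?mul0r // [E]flatmx0 mulmx0 addr0.
have [N1 N1E N1_le] := IHk (dsubmx (E : 'M_(1 + k, n))).
have [N2 N2E N2_le] := gram_row_update N1 (usubmx (E : 'M_(1 + k, n))) nm.
exists N2.
  rewrite N2E N1E -addrA; congr (_ + _).
  by rewrite addrC -(@gram_vsub 1 k).
rewrite -(subrK N1 N2) -addrA -natr1 mulrDl mul1r [leRHS]addrC.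
apply: le_trans (fnormD _ _) _; apply: lerD.
  by apply: le_trans N2_le _; apply: (@fnorm_usub _ 1).
by apply: le_trans N1_le _; rewrite ler_wpM2l ?(@fnorm_dsub _ 1).
Qed.

End Gram.

(** * Backward error of a bidiagonalization with inexact left vectors *)

Section Core.
Variable R : realType.

Lemma unit_upper_trig k (B : 'M[R]_k) :
  (forall i j : 'I_k, (j < i)%N -> B i j = 0) ->
  (forall i, B i i != 0) -> B \in unitmx.
Proof.
move=> B0 Bn0; rewrite -unitmx_tr unitmxE det_trig.
  by rewrite unitfE prodf_seq_neq0; apply/allP => i _; rewrite mxE Bn0.
by apply/is_trig_mxP => i j ij; rewrite mxE B0.
Qed.

Lemma unit_upper_unitriangular k (S : 'M[R]_k) :
  (forall i j : 'I_k, (j <= i)%N -> S i j = 0) -> 1%:M + S \in unitmx.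
Proof.
move=> S0; apply: unit_upper_trig => [i j ji|i]; rewrite !mxE.
  by rewrite S0 ?(ltnW ji) // addr0 -val_eqE gtn_eqF.
by rewrite eqxx S0 // addr0 oner_neq0.
Qed.

(** The matrix [S] measures the loss of orthogonality of the columns of [U], and
[N] is the term that couples the last step to the next right vector.  The
bound involves only the defect [H] of the right recurrence, so that [S] may be
of order one. *)
Lemma bidiag_perturbation m n k (M : 'M[R]_(m, n)) (V : 'M_(n, k))
    (U : 'M_(m, k)) (B S : 'M_k) (N H : 'M_(k, n)) :
  (n <= m)%N -> V^T *m V = 1%:M -> B \in unitmx -> M *m V = U *m B ->
  (forall i j : 'I_k, (j <= i)%N -> S i j = 0) ->
  U^T *m U = 1%:M + S + S^T ->
  S^T *m N = 0 -> N *m V = 0 ->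
  U^T *m M = (1%:M + S)^T *m B *m V^T + N + H ->
  exists (Ubar : 'M_(m, k)) (E : 'M_(m, n)),
  [/\ Ubar^T *m Ubar = 1%:M, (M + E) *m V = Ubar *m B,
      (M + E)^T *m Ubar = V *m B^T + N^T &
      fnorm E <= (3 + 4 * k%:R) * fnorm H].
Proof.
move=> nm V1 Bu MV S0 UU SN NV UM.
have Ku : 1%:M + S \in unitmx by apply: unit_upper_unitriangular.
have ST : (1%:M + S)^T = 1%:M + S^T by rewrite linearD /= trmx1.
set K := invmx (1%:M + S).
have KE : K + K *m S = 1%:M by rewrite -{1}[K]mulmx1 -mulmxDr mulVmx.
have EK : K + S *m K = 1%:M by rewrite -{1}[K]mul1mx -mulmxDl mulmxV.
have SK : S *m K = K *m S by apply: (addrI K); rewrite KE.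
(* [N V = 0] and [V^T V = 1] leave [H V] as the only source of [S B]. *)
have SB : S *m B = H *m V.
  have := congr1 (mulmx^~ V) UM; rewrite /= !mulmxDl NV addr0 -!mulmxA MV.
  rewrite V1 mulmx1 mulmxA UU ST !mulmxDl mul1mx.
  by rewrite -!addrA => /addrI; rewrite [RHS]addrC => /addIr.
set P := S *m K; have PE : P = 1%:M - K by rewrite -EK addrAC subrr add0r.
(* [N] lives in the last row, which the unit lower triangular [K^T] fixes. *)
have KTN : K^T *m N = N.
  rewrite -[in RHS](mul1mx N) -trmx1 -EK linearD /= trmx_mul mulmxDl.
  by rewrite -mulmxA SN mulmx0 addr0.
(* [W] is orthonormal for every size of [S]; its blocks are therefore
   contractions, which bounds [K] as well because [P = 1 - K]. *)
set W := col_mx P (U *m K).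
have W1 : W^T *m W = 1%:M.
  have -> : W^T *m W = K^T *m (S^T *m S + U^T *m U) *m K.
    by rewrite tr_col_mx mul_row_col /P !trmx_mul mulmxDr mulmxDl !mulmxA.
  rewrite UU; have -> : S^T *m S + (1%:M + S + S^T) = (1%:M + S)^T *m (1%:M + S).
    by rewrite ST mulmxDl mul1mx mulmxDr mulmx1 addrC -!addrA.
  by rewrite mulmxA -trmx_mul mulmxV // trmx1 mul1mx mulmxV.
have [VT V2] := range_proj V1; have [CT C2] := compl_proj V1.
have W_le q (X : 'M_(k, q)) : fnorm (W *m X) = fnorm X by apply: fnorm_isometry.
have P_le q (X : 'M_(k, q)) : fnorm (P *m X) <= fnorm X.
  by have := fnorm_usub (W *m X); rewrite W_le mul_col_mx col_mxKu.
have UK_le q (X : 'M_(k, q)) : fnorm (U *m K *m X) <= fnorm X.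
  by have := fnorm_dsub (W *m X); rewrite W_le mul_col_mx col_mxKd.
have K_le q (X : 'M_(k, q)) : fnorm (K *m X) <= 2 * fnorm X.
  have -> : K = 1%:M - P by rewrite PE opprB addrC subrK.
  rewrite mulmxBl mul1mx; apply: le_trans (fnormB _ _) _.
  by have := P_le _ X; lra.
have KT_le : fnorm (K^T *m H) <= 2 * fnorm H.
  by apply: fnorm_adjoint => // Y; apply: K_le.
set Y := H *m (V *m V^T); set Z := K^T *m H *m (1%:M - V *m V^T).
have Y_le : fnorm Y <= fnorm H by apply: fnorm_projr.
have Z_le : fnorm Z <= 2 * fnorm H by apply: le_trans (fnorm_projr _ CT C2) _.
(* [W B] differs from [(0; M V)] by [(K H V; - U K H V)]: this is corrected
   along [V] by [Y].  The term [Z] removes the defect [K^T H] of the transposed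
   relation on the orthogonal complement of [V], where it cannot disturb the
   first relation. *)
pose Ah := col_mx (K *m Y - P *m Z) (M - U *m K *m Y - U *m K *m Z).
have ZV : Z *m V = 0 by rewrite -mulmxA compl_proj_mul // mulmx0.
have YV : Y *m V = S *m B by rewrite -!mulmxA V1 mulmx1 SB.
have AhV : Ah *m V = W *m B.
  rewrite !mul_col_mx !mulmxBl -(mulmxA K Y) -(mulmxA P Z) -(mulmxA _ Y V).
  rewrite -(mulmxA _ Z V) YV ZV !mulmx0 !subr0 MV; congr col_mx.
    by rewrite mulmxA -SK.
  by rewrite !mulmxA -!mulmxBl -(mulmxA U) -{1}[U]mulmx1 -mulmxBr -KE addrK.
have WAh : W^T *m Ah = B *m V^T + N.
  have -> : Ah = col_mx 0 M + (W *m B - col_mx 0 (M *m V)) *m V^T - W *m Z.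
    rewrite !mul_col_mx opp_col_mx !add_col_mx mul_col_mx add_col_mx.
    rewrite opp_col_mx add_col_mx.
    congr col_mx.
      rewrite add0r subr0; congr (_ - _).
      by rewrite /P SK -(mulmxA K S) SB /Y !mulmxA.
    congr (_ - _); congr (_ + _).
    have -> : M *m V = U *m (K + K *m S) *m B by rewrite KE mulmx1.
    rewrite mulmxDr [(_ + _) *m B]mulmxDl opprD addrA subrr add0r mulNmx.
    by rewrite /Y (mulmxA H) -SB !mulmxA.
  rewrite mulmxBr mulmxDr !mulmxA W1 mul1mx mulmxBr !mulmxA W1 mul1mx.
  rewrite tr_col_mx !mul_row_col !mulmx0 !add0r trmx_mul -!mulmxA UM.
  rewrite (mulmxA U^T) UM /Z.
  have KX : K^T *m ((1%:M + S)^T *m B *m V^T + N + H) =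
      B *m V^T + N + K^T *m H.
    by rewrite !mulmxDr KTN !mulmxA -trmx_mul mulmxV // trmx1 mul1mx.
  have cancel : B - K^T *m (((1%:M + S)^T *m B *m V^T + N + H) *m V) =
      - (K^T *m H *m V).
    rewrite mulmxA KX !mulmxDl NV addr0 -(mulmxA B) V1 mulmx1.
    by rewrite opprD addrA subrr add0r.
  rewrite KX cancel mulNmx !mulmxA mulmxBr mulmx1 !mulmxA.
  by rewrite opprB addrA subrK addrK.
(* Both relations survive the passage to any matrix with the same Gram matrix,
   with [W] replaced by [M' V B^-1]. *)
have [M' M'M M'_le] := gram_update (dsubmx Ah) (usubmx Ah) nm.
have {}M'M : M'^T *m M' = Ah^T *m Ah by rewrite M'M addrC -gram_vsub.
exists (M' *m V *m invmx B), (M' - M).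
have -> : M + (M' - M) = M' by rewrite addrC subrK.
split.
- rewrite !trmx_mul -!mulmxA (mulmxA M'^T) M'M -mulmxA (mulmxA Ah) AhV.
  rewrite -(mulmxA W) mulmxV // mulmx1 (mulmxA V^T) -trmx_mul AhV trmx_mul.
  by rewrite -(mulmxA B^T) W1 mulmx1 -trmx_mul mulmxV ?trmx1.
- by rewrite mulmxKV.
- rewrite !mulmxA M'M -(mulmxA Ah^T) AhV -!mulmxA mulmxV // mulmx1.
  by rewrite -[W]trmxK -trmx_mul WAh linearD /= trmx_mul trmxK.
have u_le : fnorm (usubmx Ah) <= 4 * fnorm H.
  rewrite col_mxKu; apply: le_trans (fnormB _ _) _.
  by have := K_le _ Y; have := P_le _ Z; lra.
have d_le : fnorm (dsubmx Ah - M) <= 3 * fnorm H.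
  rewrite col_mxKd addrAC [M - _ - M]addrAC subrr add0r -opprD fnormN -mulmxDr.
  by apply: le_trans (UK_le _ _) _; apply: le_trans (fnormD _ _) _; lra.
rewrite -(subrK (dsubmx Ah) M') -addrA; apply: le_trans (fnormD _ _) _.
apply: le_trans (lerD M'_le d_le) _.
by have := ler_wpM2l (ler0n R k) u_le; lra.
Qed.
End Core.

(** * Residuals of the inner least squares problems *)

Section LeastSquares.
Variable R : realType.

(** The Penrose equations make [C X] symmetric and the identity on the range of
[Q], whence [Q^T r = Q^T X^T C^T r] for the pseudo-inverse [X]. *)
Lemma range_le_normal m n (C Q : 'M[R]_(m, n)) (T : 'M_n) (r : 'cV_m) :
  compact_QR C Q T ->
  fnorm (Q^T *m r) <= mxnorm2 (MP_inverse C) * fnorm (C^T *m r).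
Proof.
move=> [CE Q1 _ Tu].
have [CXC _ CXT _] : is_MP_inverse C (MP_inverse C).
  apply: (@xgetPex _ 0 [set X | is_MP_inverse C X]%classic).
  exists (invmx T *m Q^T); rewrite /= /is_MP_inverse CE.
  have QQ : Q *m T *m (invmx T *m Q^T) = Q *m Q^T by rewrite mulmxA mulmxK.
  have TT : invmx T *m Q^T *m (Q *m T) = 1%:M.
    by rewrite mulmxA -(mulmxA _ Q^T) Q1 mulmx1 mulVmx.
  by rewrite -mulmxA TT QQ mulmx1 mul1mx trmx1 trmx_mul trmxK.
set X := MP_inverse C in CXC CXT *.
have CXQ : C *m X *m Q = Q.
  by apply: (can_inj (mulmxK Tu)); rewrite -(mulmxA _ Q T) -CE CXC.
have QCX : Q^T *m (C *m X) = Q^T by rewrite -CXT -trmx_mul CXQ.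
apply: le_trans (mxnorm2_trP X _).
rewrite -QCX -CXT trmx_mul -mulmxA -(mulmxA _ C^T).
exact: fnorm_coisometry.
Qed.

(** The product form also holds when the denominator vanishes, where the
quotient says nothing: then [C] or [r] is zero. *)
Lemma stop_criterion_mul m n (C : 'M[R]_(m, n)) (r : 'cV_m) (tau : R) :
  norm2 (C^T *m r) / (mxnorm2 C * norm2 r) <= tau ->
  fnorm (C^T *m r) <= tau * (mxnorm2 C * fnorm r).
Proof.
rewrite !norm2E.
have [Cr0|nz] := eqVneq (mxnorm2 C * fnorm r) 0.
  by move=> _; rewrite Cr0 mulr0 -Cr0 mxnorm2_trP.
by rewrite ler_pdivrMr // lt_def nz mulr_ge0 ?mxnorm2_ge0 ?fnorm_ge0.
Qed.

(** The component of [r] orthogonal to the range is that of the unit vector [b],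
so [|r| <= 1 + |r| / 2], that is [|r| <= 2]. *)
Lemma range_residual_le m n (Q : 'M[R]_(m, n)) (b r : 'cV_m) (x : 'cV_n)
    (eps : R) :
  Q^T *m Q = 1%:M -> fnorm b = 1 -> r = b - Q *m x ->
  0 <= eps <= 2^-1 -> fnorm (Q^T *m r) <= eps * fnorm r ->
  fnorm (Q^T *m r) <= 2 * eps.
Proof.
move=> Q1 b1 rE /andP[eps_ge0 eps_le] le_r.
have [CT C2] := compl_proj Q1.
have r_split : r = (1%:M - Q *m Q^T) *m b + Q *m (Q^T *m r).
  have -> : (1%:M - Q *m Q^T) *m b = (1%:M - Q *m Q^T) *m r.
    rewrite rE mulmxBr; suff -> : (1%:M - Q *m Q^T) *m (Q *m x) = 0.
      by rewrite subr0.
    by rewrite mulmxA mulmxBl mul1mx -(mulmxA Q) Q1 mulmx1 subrr mul0mx.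
  by rewrite mulmxBl mul1mx mulmxA subrK.
have r_le2 : fnorm r <= 2.
  have : fnorm r <= 1 + fnorm (Q^T *m r).
    rewrite {1}r_split; apply: le_trans (fnormD _ _) _.
    by rewrite (fnorm_isometry _ Q1) lerD2r -[leRHS]b1 fnorm_proj.
  by have := ler_wpM2r (fnorm_ge0 r) eps_le; lra.
by apply: le_trans le_r _; rewrite mulrC ler_wpM2r.
Qed.

End LeastSquares.

(** * Matrices with columns taken from a sequence, and bidiagonal matrices *)

Section Columns.
Variables (R : realType) (n : nat).
Implicit Types (v : nat -> 'cV[R]_n) (w : 'cV[R]_n).

Lemma trVmx_mulE v k w i : ((Vmx v k)^T *m w) i 0 = fdot (v i.+1) w.
Proof.
rewrite mxE /fdot trace_mx11 mxE; apply: eq_bigr => j _.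
by rewrite !mxE.
Qed.

Lemma gram_VmxE m v (w : nat -> 'cV[R]_n) k (i : 'I_m) (j : 'I_k) :
  ((Vmx v m)^T *m Vmx w k) i j = fdot (v i.+1) (w j.+1).
Proof.
rewrite mxE /fdot trace_mx11 mxE; apply: eq_bigr => l _.
by rewrite !mxE.
Qed.

Lemma Vmx_mulE v k (c : 'cV[R]_k) :
  Vmx v k *m c = \sum_(i < k) c i 0 *: v i.+1.
Proof.
apply/colP => a; rewrite mxE summxE; apply: eq_bigr => i _.
by rewrite !mxE mulrC.
Qed.

Lemma Vmx_projE v k w :
  \sum_(1 <= j < k.+1) (w^T *m v j) 0 0 *: v j = Vmx v k *m (Vmx v k)^T *m w.
Proof.
rewrite big_add1 /= big_mkord -mulmxA Vmx_mulE; apply: eq_bigr => i _.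
by rewrite trVmx_mulE fdotC /fdot trace_mx11.
Qed.

Lemma Vmx_orthonormalS v k :
  (Vmx v k)^T *m Vmx v k = 1%:M -> fnorm (v k.+1) = 1 ->
  (Vmx v k)^T *m v k.+1 = 0 -> (Vmx v k.+1)^T *m Vmx v k.+1 = 1%:M.
Proof.
move=> Vk v1 Vv; have Vk_dot a b : (a < k)%N -> (b < k)%N ->
    fdot (v a.+1) (v b.+1) = (a == b)%:R.
  move=> ak bk; have := congr1 (fun X : 'M_k => X (Ordinal ak) (Ordinal bk)) Vk.
  by rewrite gram_VmxE mxE.
have Vv_dot a : (a < k)%N -> fdot (v a.+1) (v k.+1) = 0.
  by move=> ak; rewrite -(trVmx_mulE v _ (Ordinal ak)) Vv mxE.
apply/matrixP => -[a ak] [b bk]; rewrite gram_VmxE !mxE -val_eqE /=.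
move: (ak) (bk); rewrite (ltnS a) (ltnS b) (leq_eqVlt a) (leq_eqVlt b).
move=> /orP[/eqP->|ltak] /orP[/eqP->|ltbk].
- by rewrite eqxx -fnorm_sqr v1 expr1n.
- by rewrite fdotC Vv_dot // gtn_eqF.
- by rewrite Vv_dot // ltn_eqF.
- exact: Vk_dot.
Qed.

End Columns.

(** Column [j] of a bidiagonal matrix has two entries.  The convention [b 0 = 0]
extends the formula to the first column, where [x j.-1] is a dummy value. *)
Lemma mul_BmxE (R : realType) (a b x : nat -> R) k (j : 'I_k) : b 0 = 0 ->
  \sum_(l < k) x l * Bmx a b k l j = x j * a j.+1 + x j.-1 * b j.
Proof.
move=> b0; rewrite (bigD1 j) //= !mxE eqxx; congr (_ + _).
case: j => -[|j] jk /=.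
  rewrite b0 mulr0 big1 // => l; rewrite -val_eqE /= => /negPf l0.
  by rewrite mxE /= eq_sym l0 mulr0.
rewrite (bigD1 (Ordinal (ltnW jk))) /=; last by rewrite -val_eqE /= ltn_eqF.
rewrite mxE /= gtn_eqF // eqxx big1 ?addr0 // => l /andP[lj lj'].
rewrite mxE /= -!val_eqE /= in lj lj' *.
by rewrite eq_sym (negPf lj) eqSS eq_sym (negPf lj') mulr0.
Qed.

(** * The recurrences of the process in matrix form *)

Section Process.
Variables (R : realType) (m n p k : nat).
Variables (A : 'M[R]_(m, n)) (L : 'M[R]_(p, n)).
Variables (Q : 'M[R]_(m + p, n)) (T : 'M[R]_n) (tau : R).
Variables (D : rJBD_run R m n p) (v : nat -> 'cV[R]_n).

Let C : 'M[R]_(m + p, n) := col_mx A L.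
Let M : 'M[R]_(m, n) := usubmx Q.
Let B : 'M[R]_k := Bmx (alpha D) (beta D) k.
Let eps : R := 2 * (cond2 C * tau).

Hypothesis k_n : (1 <= k <= n)%N.
Hypothesis CQT : compact_QR C Q T.
Hypothesis tau_ge0 : 0 <= tau.
Hypothesis run : rJBD_process A L tau D k.
Hypothesis vtE : forall i : nat, (1 <= i <= k.+1)%N -> vt D i = Q *m v i.
Hypothesis small : cond2 C * tau <= 2^-1.

(** The component of the inner residual in the range of [C], in coordinates with
respect to the columns of [Q]. *)
Definition inner_error i : 'cV[R]_n := Q^T *m inner_residual A L D i.

Let CE : C = Q *m T. Proof. by case: CQT. Qed.
Let Q1 : Q^T *m Q = 1%:M. Proof. by case: CQT. Qed.

Lemma cond2_tau_ge0 : 0 <= cond2 C * tau.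
Proof. by rewrite !mulr_ge0 ?mxnorm2_ge0. Qed.

Let eps_ge0 : 0 <= eps.
Proof. by apply: mulr_ge0; rewrite ?cond2_tau_ge0. Qed.

Lemma inner_error_le i : (1 <= i <= k)%N -> fnorm (inner_error i) <= eps.
Proof.
move=> ik; have [_ u1 _ stop _ _ _ _ _ _ _ _ _] := steps run ik.
apply: (@range_residual_le _ _ _ Q (ut D i) (inner_residual A L D i)
  (T *m zbar D i) (cond2 C * tau)) => //.
- rewrite norm2E in u1; apply: (@pexpIrn _ 2); rewrite ?nnegrE ?fnorm_ge0 //.
  by rewrite fnorm_col_mx u1 fnorm0 !expr1n expr0n addr0.
- by rewrite mulmxA -CE.
- by rewrite cond2_tau_ge0.
apply: le_trans (range_le_normal _ CQT) _.
have := stop_criterion_mul stop; rewrite -/C => le_stop.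
apply: le_trans (ler_wpM2l (mxnorm2_ge0 _) le_stop) _.
by rewrite /cond2 le_eqVlt; apply/orP; left; apply/eqP; ring.
Qed.

Lemma inner_errorE i : inner_error i = M^T *m u D i - T *m zbar D i.
Proof.
rewrite /inner_error /inner_residual -/C CE mulmxBr !mulmxA Q1 mul1mx.
by rewrite /ut -{1}(vsubmxK Q) tr_col_mx mul_row_col mulmx0 addr0.
Qed.

Lemma u_dot_self i : (1 <= i <= k)%N -> fdot (u D i) (u D i) = 1.
Proof.
move=> ik; have [_ u1 _ _ _ _ _ _ _ _ _ _ _] := steps run ik.
by rewrite -fnorm_sqr -norm2E u1 expr1n.
Qed.

Lemma v_normalized i : (1 <= i <= k)%N -> fnorm (v i) = 1.
Proof.
case: i => // i /andP[_ ik]; rewrite -(fnorm_isometry _ Q1) -vtE; last first.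
  by rewrite /= ltnS ltnW.
case: i ik => [|i] ik; last first.
  have ik' : (1 <= i.+1 <= k)%N by rewrite /= ltnW.
  have [_ _ _ _ _ vt1 _ _ _ _ _ _ _] := steps run ik'.
  rewrite -norm2E vt1 //.
  by apply: leq_trans ik _; case/andP: k_n.
rewrite (vt1_eq run) fnormZ !norm2E -/C ger0_norm ?invr_ge0 ?fnorm_ge0 //.
rewrite mulVf //; apply/eqP => /fnorm0_eq0; rewrite CE => Cs0.
have [_ _ _ Tu] := CQT; have /eqP := start_neq0 run; apply.
rewrite -(mulKmx Tu (start D)) -[T *m _]mul1mx -Q1 -!mulmxA (mulmxA Q) Cs0.
by rewrite !mulmx0.
Qed.

(** As [Q] is an isometry, the Gram-Schmidt step on the vectors [vt] is the same
step on the coordinate vectors [v]. *)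
Lemma next_direction i : (1 <= i <= k)%N ->
  beta D i *: v i.+1 =
    (1%:M - Vmx v i *m (Vmx v i)^T) *m (T *m zbar D i - alpha D i *: v i).
Proof.
move=> ik; have /andP[i1 i2] := ik.
have [_ _ _ _ right _ _ _ _ _ _ _ _] := steps run ik.
have sE : rJBD_s A L D i = Q *m (T *m zbar D i - alpha D i *: v i).
  rewrite /rJBD_s -/C CE vtE; last by rewrite i1 leqW.
  by rewrite mulmxBr mulmxA scalemxAr.
move: (T *m _ - _) sE => y sE.
have Qinj : injective (mulmx Q : 'cV_n -> _).
  by move=> a b /(congr1 (mulmx Q^T)); rewrite !mulmxA Q1 !mul1mx.
apply: Qinj; rewrite -scalemxAr -vtE; last by rewrite ltnS.
rewrite right sE mulmxBl mul1mx mulmxBr; congr (_ - _).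
rewrite -Vmx_projE mulmx_sumr; apply: eq_big_nat => j /andP[j1 j2].
rewrite vtE; last by rewrite j1 (leq_trans (ltnW j2)).
rewrite trmx_mul -scalemxAr; congr (_ *: _); congr (_ 0 0).
by rewrite mulmxA -(mulmxA _ Q^T) Q1 mulmx1.
Qed.

Lemma Vmx_orthonormal i : (i <= k)%N -> (Vmx v i)^T *m Vmx v i = 1%:M.
Proof.
elim: i => [|i IHi] ik; first by apply/matrixP => -[].
have Vi := IHi (ltnW ik); apply: Vmx_orthonormalS => //.
  by apply: v_normalized.
case: i => [|i] in IHi ik Vi *; first by apply/colP => -[].
have ik' : (1 <= i.+1 <= k)%N by rewrite /= ltnW.
have [_ _ _ _ _ _ beta_gt0 _ _ _ _ _ _] := steps run ik'.
have {}beta_gt0 : 0 < beta D i.+1.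
  by apply: beta_gt0; apply: leq_trans ik _; case/andP: k_n.
apply: (scalerI (lt0r_neq0 beta_gt0)); rewrite scaler0 scalemxAr.
by rewrite next_direction // mulmxA tr_mul_compl_proj // mul0mx.
Qed.

(** Stated for the product because for [k = n] the product vanishes and the
vector [v_(k+1)] is not normalized. *)
Lemma last_direction_orthogonal : (Vmx v k)^T *m (beta D k *: v k.+1) = 0.
Proof.
rewrite next_direction; last by case/andP: k_n => -> _ /=.
by rewrite mulmxA tr_mul_compl_proj ?Vmx_orthonormal // mul0mx.
Qed.

Lemma left_recurrence i : (1 <= i <= k)%N ->
  M *m v i = alpha D i *: u D i + beta D i.-1 *: u D i.-1.
Proof.
move=> ik; have [-> _ _ _ _ _ _ _ _ _ _ _ _] := steps run ik.
rewrite subrK vtE; last by case/andP: ik => -> /leqW.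
by rewrite mul_usub_mx.
Qed.

(** Reorthogonalization projects the inner error away from the previous right
vectors; what remains is the defect of the right recurrence. *)
Definition right_defect i : 'cV[R]_n :=
  (1%:M - Vmx v i *m (Vmx v i)^T) *m inner_error i.

(** The orthogonal projection also kills the term [alpha_i v_i] subtracted in
forming the new direction. *)
Lemma right_recurrence i : (1 <= i <= k)%N ->
  M^T *m u D i =
    Vmx v i *m (Vmx v i)^T *m (M^T *m u D i) + beta D i *: v i.+1
    + right_defect i.
Proof.
move=> ik; rewrite next_direction // -addrA -mulmxDr inner_errorE.
set w := M^T *m _; set z := T *m _.
have -> : z - alpha D i *: v i + (w - z) = w - alpha D i *: v i.
  by rewrite addrC addrA subrK.
suff -> : (1%:M - Vmx v i *m (Vmx v i)^T) *m (w - alpha D i *: v i) =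
    (1%:M - Vmx v i *m (Vmx v i)^T) *m w.
  by rewrite mulmxBl mul1mx addrC subrK.
rewrite mulmxBr -scalemxAr; suff -> : (1%:M - Vmx v i *m (Vmx v i)^T) *m v i = 0.
  by rewrite scaler0 subr0.
case: i ik {w z} => // i ik.
have -> : v i.+1 = Vmx v i.+1 *m delta_mx ord_max 0.
  by rewrite -colE; apply/colP => a; rewrite !mxE.
by rewrite mulmxA compl_proj_mul ?mul0mx // Vmx_orthonormal; case/andP: ik.
Qed.

Lemma right_defect_le i : (1 <= i <= k)%N -> fnorm (right_defect i) <= eps.
Proof.
move=> ik; apply: le_trans (inner_error_le ik).
have Vi := Vmx_orthonormal (proj2 (andP ik)).
by have [VT V2] := compl_proj Vi; apply: fnorm_proj.
Qed.

Let U := Vmx (u D) k.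
Let V := Vmx v k.

Definition left_coupling : 'M[R]_k :=
  \matrix_(i, j) if (i < j)%N then fdot (u D i.+1) (u D j.+1) else 0.

Definition tail_mx : 'M[R]_(k, n) :=
  beta D k *: (unit_col R k k *m (v k.+1)^T).

Definition right_defect_mx : 'M[R]_(k, n) :=
  \matrix_(i < k) (right_defect i.+1)^T.

Lemma ord_succ_range (i : 'I_k) : (1 <= i.+1 <= k)%N.
Proof. by rewrite /= ltn_ord. Qed.

Lemma left_gram : U^T *m U = 1%:M + left_coupling + left_coupling^T.
Proof.
apply/matrixP => i j; rewrite gram_VmxE !mxE -val_eqE /=.
case: ltngtP => [ij|ij|/val_inj ->]; rewrite ?add0r ?addr0 //.
  by rewrite fdotC.
by rewrite u_dot_self ?ord_succ_range.
Qed.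

Lemma left_bidiagonal : M *m V = U *m B.
Proof.
apply/matrixP => a j.
have -> : (M *m V) a j = (M *m v j.+1) a 0.
  by rewrite mxE [RHS]mxE; apply: eq_bigr => l _; rewrite [V _ _]mxE.
rewrite left_recurrence ?ord_succ_range // [RHS]mxE.
under eq_bigr do rewrite [U _ _]mxE.
rewrite (mul_BmxE _ (fun l => u D l.+1 a 0)) ?(beta0_eq run) // !mxE.
case: j => -[|j] jk /=; last by ring.
by rewrite (beta0_eq run) mul0r mulr0 mulrC.
Qed.

(** Row [i] of [(1 + S)^T] holds the inner products of [u_i] with the first [i]
left vectors.
For [j <= i] the entry of [(1 + S)^T B] therefore involves complete columns of
[U B = M V] and equals the inner product of [v_j] with [M^T u_i]; for
[j = i + 1] only [beta_i |u_i|^2 = beta_i] is left, and beyond it nothing.  This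
is the expansion given by [right_recurrence]. *)
Lemma right_bidiagonal :
  U^T *m M = (1%:M + left_coupling)^T *m B *m V^T + tail_mx + right_defect_mx.
Proof.
apply/matrixP => i a.
have -> : (U^T *m M) i a = (M^T *m u D i.+1) a 0.
  rewrite mxE [RHS]mxE; apply: eq_bigr => l _.
  by rewrite [U^T _ _]mxE [U _ _]mxE [M^T _ _]mxE mulrC.
rewrite {1}right_recurrence ?ord_succ_range //; set y := M^T *m _.
rewrite mxE [RHS]mxE; congr (_ + _); last by rewrite [RHS]mxE [RHS]mxE.
rewrite mxE [RHS]mxE.
pose c j := if (j <= i)%N then fdot (v j.+1) y
            else if j == i.+1 then beta D j else 0.
have LB (j : 'I_k) : ((1%:M + left_coupling)^T *m B) i j = c j.
  pose x l := if (l <= i)%N then fdot (u D l.+1) (u D i.+1) else 0.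
  have xE (l : 'I_k) : (1%:M + left_coupling)^T i l = x l.
    rewrite !mxE -val_eqE /= /x.
    case: ltngtP => [li|li|/val_inj ->]; rewrite ?add0r ?addr0 //.
    by rewrite u_dot_self ?ord_succ_range.
  rewrite mxE; under eq_bigr do rewrite xE.
  rewrite mul_BmxE ?(beta0_eq run) // /x /c.
  case: ltnP => [ij|ji].
    rewrite mul0r add0r.
    case: eqP => [ji|ji].
      by rewrite ji /= leqnn u_dot_self ?ord_succ_range // mul1r.
    have -> : (j.-1 <= i)%N = false by lia.
    by rewrite mul0r.
  rewrite /y -fdot_mulmxl left_recurrence ?ord_succ_range // fdotDl !fdotZl.
  case: j ji => -[|j] jk /= ji.
    by rewrite (beta0_eq run) mulr0 mul0r !addr0 mulrC.
  by rewrite (ltnW ji) mulrC (mulrC (beta D j.+1)).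
have -> : ((1%:M + left_coupling)^T *m B *m V^T) i a =
    \sum_(0 <= j < k) c j * v j.+1 a 0.
  rewrite mxE big_mkord; apply: eq_bigr => j _.
  by rewrite LB [V^T _ _]mxE mxE.
have -> : (Vmx v i.+1 *m (Vmx v i.+1)^T *m y) a 0 =
    \sum_(0 <= j < i.+1) c j * v j.+1 a 0.
  rewrite -mulmxA Vmx_mulE summxE big_mkord; apply: eq_bigr => j _.
  by rewrite mxE trVmx_mulE /c -ltnS ltn_ord.
(* The terms beyond [i] of the sum reduce to the superdiagonal one, or, in the
   last row, are supplied by the tail. *)
rewrite [in RHS](big_cat_nat _ (n := i.+1)) //= -[RHS]addrA; congr (_ + _).
rewrite /tail_mx !mxE big_ord1 !mxE.
have [ik|ki] := ltnP i.+1 k.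
  rewrite big_ltn // big1_seq => [|j]; last first.
    rewrite mem_index_iota /c => /andP[_ /andP[ij _]].
    by rewrite leqNgt (ltnW ij) /= gtn_eqF // mul0r.
  by rewrite /c ltnn eqxx (ltn_eqF ik) mul0r mulr0 !addr0.
have kE : k = i.+1 by apply/eqP; rewrite eqn_leq ki ltn_ord.
by rewrite big_geq // add0r -kE eqxx mul1r.
Qed.

Lemma left_coupling_upper (i j : 'I_k) : (j <= i)%N -> left_coupling i j = 0.
Proof. by move=> ji; rewrite mxE ltnNge ji. Qed.

Lemma left_coupling_tail_mx : left_coupling^T *m tail_mx = 0.
Proof.
rewrite /tail_mx -scalemxAr mulmxA; suff -> : left_coupling^T *m unit_col R k k = 0.
  by rewrite mul0mx scaler0.
apply/colP => i; rewrite !mxE big1 // => j _; rewrite !mxE.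
case: eqP => [jk|_]; last by rewrite mulr0.
by rewrite ltnNge -ltnS jk ltn_ord mul0r.
Qed.

Lemma tail_mx_V : tail_mx *m V = 0.
Proof.
apply: trmx_inj; rewrite trmx0 /tail_mx trmx_mul linearZ /= trmx_mul trmxK.
by rewrite scalemxAl mulmxA last_direction_orthogonal mul0mx.
Qed.

Lemma B_unit : B \in unitmx.
Proof.
apply: unit_upper_trig => [i j ji|i]; rewrite mxE.
  by rewrite (ltn_eqF ji) ltn_eqF // ltnS ltnW.
have [_ _ alpha_gt0 _ _ _ _ _ _ _ _ _ _] := steps run (ord_succ_range i).
by rewrite eqxx gt_eqF.
Qed.

Lemma right_defect_mx_le : fnorm right_defect_mx <= Num.sqrt k%:R * eps.
Proof.
rewrite -ler_sqr ?nnegrE ?fnorm_ge0 ?(mulr_ge0 (sqrtr_ge0 _) eps_ge0) //.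
rewrite fnorm_rows exprMn sqr_sqrtr ?ler0n //.
rewrite mulr_natl -[k in leRHS]card_ord -sumr_const; apply: ler_sum => i _.
rewrite ler_sqr ?nnegrE ?fnorm_ge0 ?eps_ge0 // rowK fnorm_tr.
exact/right_defect_le/ord_succ_range.
Qed.

Lemma rJBD_backward_error : (n <= m)%N ->
  exists (Ubar : 'M[R]_(m, k)) (E : 'M[R]_(m, n)),
  [/\ col_orthonormal Ubar,
      (M + E) *m V = Ubar *m B,
      (M + E)^T *m Ubar =
        V *m B^T + beta D k *: (v k.+1 *m (unit_col R k k)^T)
    & mxnorm2 E <= 14 * (Num.sqrt n%:R * k%:R * cond2 C * tau)].
Proof.
move=> nm; have [Ubar [E [Ubar1 EV EU E_le]]] :=
  bidiag_perturbation nm (Vmx_orthonormal (leqnn k)) B_unit left_bidiagonal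
    left_coupling_upper left_gram left_coupling_tail_mx tail_mx_V
    right_bidiagonal.
exists Ubar, E; split=> //.
  by rewrite EU /tail_mx linearZ /= trmx_mul trmxK.
apply: le_trans (mxnorm2_le_fnorm _) _; apply: le_trans E_le _.
have [k1 kn] := andP k_n.
have k_ge1 : 1 <= k%:R :> R by rewrite ler1n.
have sqrt_kn : Num.sqrt k%:R <= Num.sqrt n%:R :> R.
  by rewrite ler_wsqrtr // ler_nat.
(* [3 + 4 k <= 7 k] and [sqrt k <= sqrt n]. *)
apply: (@le_trans _ _ (7 * k%:R * (Num.sqrt n%:R * eps))); last first.
  by rewrite /eps le_eqVlt; apply/orP; left; apply/eqP; ring.
apply: ler_pM; rewrite ?fnorm_ge0 ?addr_ge0 ?mulr_ge0 ?ler0n //; first by lra.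
apply: le_trans right_defect_mx_le _; exact: ler_wpM2r.
Qed.

End Process.

(** * The backward error bound for the reorthogonalized process *)

Theorem theorem4p2 (R : realType) :
  exists c : R, 0 < c /\
  forall m n p k : nat, (n <= m)%N -> (1 <= k <= n)%N ->
  exists delta : R, 0 < delta /\
  forall (A : 'M[R]_(m, n)) (L : 'M[R]_(p, n))
    (Q : 'M[R]_(m + p, n)) (T : 'M[R]_n) (tau : R)
    (D : rJBD_run R m n p) (v : nat -> 'cV[R]_n),
  \rank (col_mx A L) = n ->
  compact_QR (col_mx A L) Q T ->
  0 <= tau ->
  rJBD_process A L tau D k ->
  (forall i : nat, (1 <= i <= k.+1)%N -> vt D i = Q *m v i) ->
  cond2 (col_mx A L) * tau <= delta ->
  exists (Ubar : 'M[R]_(m, k)) (E : 'M[R]_(m, n)),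
  [/\ col_orthonormal Ubar,
      (usubmx Q + E) *m Vmx v k = Ubar *m Bmx (alpha D) (beta D) k,
      (usubmx Q + E)^T *m Ubar =
        Vmx v k *m (Bmx (alpha D) (beta D) k)^T
        + beta D k *: (v k.+1 *m (unit_col R k k)^T)
    & mxnorm2 E <=
        c * (Num.sqrt n%:R * k%:R * cond2 (col_mx A L) * tau)].
Proof.
exists 14; split=> // m n p k nm k_n.
exists 2^-1; split; first by rewrite invr_gt0.
move=> A L Q T tau D v _ CQT tau_ge0 run vtE small.
exact: (rJBD_backward_error k_n CQT tau_ge0 run vtE small nm).
Qed.
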